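(* Let $N\in\mathbb{N}$. Assume that $(v_i)$ is in increasing order, that all weights equal $1$ (i.e. $\tilde W=\mathbf 1\mathbf 1^{\mathrm T}$ with $\mathbf 1=(1,\ldots,1)^{\mathrm T}\in\mathbb{R}^N$), and that $s\mapsto\Psi(s^2)$ is twice continuously differentiable in $(0,2)$. Then the unique minimiser of $$E(v,W)=\frac14\sum_{i=1}^{2N}\sum_{j=1}^{2N}w_{i,j}\,\Psi\big((v_j-v_i)^2\big)$$ is given by $v^*=(v_1^*,\ldots,v_{2N}^* )^{\mathrm T}$ with $v_i^*=\dfrac{i-\frac12}{N}$, $i=1,\ldots,2N$.
   Context: The energy is considered for extended position vectors $v=(v_1,\ldots,v_{2N})^{\mathrm T}\in(0,2)^{2N}$ where $v_1,\ldots,v_N\in(0,1)$ and $v_{2N+1-i}:=2-v_i\in(1,2)$ for $i=1,\ldots,N$. The weight matrix $W=(w_{i,j})\in(\mathbb{R}_0^+)^{2N\times 2N}$ satisfies $w_{i,j}=w_{i,2N+1-j}=w_{2N+1-i,j}=w_{2N+1-i,2N+1-j}$ for $1\le i,j\le N$, and $\tilde W$ denotes its upper-left $N\times N$ submatrix; so $\tilde W=\mathbf 1\mathbf 1^{\mathrm T}$ means $w_{i,j}=1$ for all $1\le i,j\le 2N$. Penaliser: $\Psi:\mathbb{R}_0^+\to\mathbb{R}$ is such that $s\mapsto\Psi(s^2)$ is continuously differentiable, decreasing and strictly convex on $[0,1]$, with $\Psi(0)=0$ and vanishing left-sided derivative at $s=1$. It is extended to $[-1,1]$ by symmetry (evenness)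 and to $\mathbb{R}$ by periodicity $\Psi((2+s)^2)=\Psi(s^2)$. *)

(* Defs.v *)
From HB Require Import structures.
From mathcomp Require Import all_boot all_order all_algebra.
From mathcomp Require Import all_classical all_reals all_analysis.
Import Order.TTheory GRing.Theory Num.Theory.
Import numFieldNormedType.Exports.

Set Implicit Arguments.
Unset Strict Implicit.
Unset Printing Implicit Defensive.

Local Open Scope classical_set_scope.
Local Open Scope ring_scope.

(* The difference quotient is restricted to D, so the derivative is one-sided
   at an end point of D. *)
Definition has_derivative_within (R : realType) (D : set R) (f : R -> R)
    (s l : R) : Prop :=
  (f t - f s) / (t - s) @[t --> within D s^'] --> l.

Definition continuously_differentiable_on (R : realType) (D : set R)
    (f : R -> R) : Prop :=
  exists df : R -> R,
    (forall s, D s -> has_derivative_within D f s (df s)) /\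
    {within D, continuous df}.

Definition twice_continuously_differentiable_on_open (R : realType) (D : set R)
    (f : R -> R) : Prop :=
  forall s, D s ->
    [/\ derivable f s 1, derivable (f^`())%classic s 1 &
      {for s, continuous (f^`(2))%classic}].

Definition strictly_convex_on (R : realType) (D : set R) (f : R -> R) : Prop :=
  forall x y t : R, D x -> D y -> x != y -> 0 < t < 1 ->
    f (t * x + (1 - t) * y) < t * f x + (1 - t) * f y.

Definition of_square (R : realType) (Psi : R -> R) : R -> R :=
  fun s => Psi (s ^+ 2).

(* A penaliser is a function on [0, +oo[; it is represented by a function on R
   all of whose conditions and uses concern squares only.  The values at
   negative arguments are irrelevant.  The last field is the periodic extension
   from [-1, 1]; evenness of s |-> Psi (s ^+ 2) holds by construction. *)
Record penaliser (R : realType) (Psi : R -> R) : Prop := Penaliser {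
  penaliser_C1 : continuously_differentiable_on `[0, 1] (of_square Psi) ;
  penaliser_decreasing :
    forall x y : R, 0 <= x -> x < y -> y <= 1 ->
      of_square Psi y < of_square Psi x ;
  penaliser_strictly_convex : strictly_convex_on `[0, 1] (of_square Psi) ;
  penaliser0 : Psi 0 = 0 ;
  penaliser_left_derivative1 :
    (of_square Psi t - of_square Psi 1) / (t - 1) @[t --> 1^'-] --> (0 : R) ;
  penaliser_periodic : periodic (of_square Psi) 2
}.

(* The 2N indices are 'I_(N + N), counted from 0: lshift N i, for i : 'I_N, runs
   over the first N of them, and rev_ord is the reflection i |-> 2N + 1 - i of
   the indices counted from 1. *)
Definition extended_position (R : realType) (N : nat) (v : 'cV[R]_(N + N)) :
    Prop :=
  forall i : 'I_N, 0 < v (lshift N i) 0 < 1 /\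
    v (rev_ord (lshift N i)) 0 = 2 - v (lshift N i) 0.

Definition increasing_order (R : realType) (n : nat) (v : 'cV[R]_n) : Prop :=
  forall i j : 'I_n, (i <= j)%N -> v i 0 <= v j 0.

Definition extended_weights (R : realType) (N : nat) (W : 'M[R]_(N + N)) :
    Prop :=
  (forall i j, 0 <= W i j) /\
  (forall i j : 'I_N, let i' := lshift N i in let j' := lshift N j in
    [/\ W i' j' = W i' (rev_ord j'),
        W i' (rev_ord j') = W (rev_ord i') j' &
        W (rev_ord i') j' = W (rev_ord i') (rev_ord j')]).

Definition energy (R : realType) (N : nat) (Psi : R -> R)
    (v : 'cV[R]_(N + N)) (W : 'M[R]_(N + N)) : R :=
  4^-1 * \sum_i \sum_j W i j * Psi ((v j 0 - v i 0) ^+ 2).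

Definition minimiser (R : realType) (T : Type) (D : set T) (f : T -> R)
    (x : T) : Prop :=
  D x /\ forall y, D y -> f x <= f y.

(* (i - 1/2) / N for i counted from 1. *)
Definition equidistant (R : realType) (N : nat) : 'cV[R]_(N + N) :=
  \col_i ((i%:R + 2^-1) / N%:R).

(* Main.v *)
(* The function phi s = Psi (s ^+ 2) is 2-periodic, symmetric about 1, and
   strictly convex on the whole of [0, 2], because it decreases to the point of
   symmetry.  Put M = 2N and continue the ordered positions to a sequence u with
   u (i + M) = u i + 2.  By periodicity four times the energy is the sum over
   k < M of the sums of phi (u (i + k) - u i) over i < M.  For fixed k the M
   arguments lie in [0, 2] and have sum 2k, so Jensen's inequality bounds the
   inner sum below by M phi (k / N), a value attained exactly when all gaps at
   distance k equal k / N.  The case k = 1 of equality, with the reflection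
   symmetry of the positions, determines u. *)
Require Import Defs.
From mathcomp Require Import all_boot all_order all_algebra.
From mathcomp Require Import all_classical all_reals all_analysis.
From mathcomp Require Import ring lra zify.
Import Order.TTheory GRing.Theory Num.Theory.
Import numFieldNormedType.Exports.
Local Open Scope classical_set_scope.
Local Open Scope ring_scope.

Set Implicit Arguments.
Unset Strict Implicit.
Unset Printing Implicit Defensive.

(** * Strict convexity on a reflected interval and the equality case of Jensen's inequality *)

Section Convexity.
Variable R : realType.

(** Reflection about 1 reduces to a barycentre at most 1. One of the two points is then at most 1,
    and exchanging them if necessary makes it [x]. *)
Lemma strictly_convex_on_reflect (f : R -> R) :
  (forall x y, 0 <= x -> x < y -> y <= 1 -> f y < f x) ->
  (forall s, f (2 - s) = f s) ->
  strictly_convex_on `[0, 1] f -> strictly_convex_on `[0, 2] f.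
Proof.
move=> fdec fsym fcvx.
have left_half x y t : 0 <= x <= 2 -> 0 <= y <= 2 -> x != y -> 0 < t < 1 ->
    x <= 1 -> t * x + (1 - t) * y <= 1 ->
    f (t * x + (1 - t) * y) < t * f x + (1 - t) * f y.
  move=> x02 y02 xy t01 x1 m1.
  have [y1|y1] := leP y 1.
    by apply: fcvx => //; rewrite /= in_itv /=; lra.
  (* replacing y by its mirror image lowers the barycentre *)
  have mlt : t * x + (1 - t) * (2 - y) < t * x + (1 - t) * y by nra.
  have m0 : 0 <= t * x + (1 - t) * (2 - y) by nra.
  apply: (lt_le_trans (fdec _ _ m0 mlt m1)).
  rewrite -(fsym y).
  (* The reflected point may coincide with [x]. Monotonicity has already given a strict inequality,
     so a weak one suffices here. *)
  have [<-|xy'] := eqVneq x (2 - y).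
    by rewrite -!mulrDl addrC subrK !mul1r.
  by apply/ltW/fcvx => //; rewrite /= in_itv /=; lra.
have below x y t : 0 <= x <= 2 -> 0 <= y <= 2 -> x != y -> 0 < t < 1 ->
    t * x + (1 - t) * y <= 1 ->
    f (t * x + (1 - t) * y) < t * f x + (1 - t) * f y.
  move=> x02 y02 xy t01 m1.
  have [x1|x1] := leP x 1; first exact: left_half.
  have y1 : y <= 1 by nra.
  have := left_half y x (1 - t) y02 x02.
  rewrite eq_sym => /(_ xy).
  have -> : 1 - (1 - t) = t by ring.
  rewrite ![(1 - t) * _ + _]addrC; apply => //; lra.
move=> x y t; rewrite /= !in_itv /= => x02 y02 xy t01.
have [m1|m1] := leP (t * x + (1 - t) * y) 1; first exact: below.
rewrite -(fsym x) -(fsym y) -(fsym (_ + _)).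
have e : 2 - (t * x + (1 - t) * y) = t * (2 - x) + (1 - t) * (2 - y) by ring.
rewrite e; apply: below => //; lra.
Qed.

(** Induction on the number of points: the new mean is a convex combination of the old mean and the
    last point. If these two agree, the mean does not change; otherwise strict convexity makes the
    inequality strict and rules out equality. *)
Lemma strict_jensen (a b : R) (f : R -> R) (x : nat -> R) (n : nat) :
  strictly_convex_on `[a, b] f ->
  (forall i, a <= x i <= b) ->
  let m := (\sum_(i < n.+1) x i) / n.+1%:R in
  [/\ a <= m <= b,
      n.+1%:R * f m <= \sum_(i < n.+1) f (x i) &
      n.+1%:R * f m = \sum_(i < n.+1) f (x i) ->
        forall i, (i <= n)%N -> x i = m].
Proof.
move=> fcvx xab; elim: n => [|n [mab IHle IHeq]] /=.
  rewrite !big_ord1 divr1 mul1r; split=> // _ i.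
  by rewrite leqn0 => /eqP ->.
rewrite !(big_ord_recr n.+1) /=.
move: mab IHle IHeq.
set s := \sum_(i < n.+1) x i; set F := \sum_(i < n.+1) f (x i).
set m := s / n.+1%:R; set y := x n.+1 => mab IHle IHeq.
have n0 : 0 < n.+1%:R :> R by rewrite ltr0n.
have sE : s = n.+1%:R * m by rewrite /m mulrC divfK // gt_eqF.
have nE : n.+2%:R = n.+1%:R + 1 :> R by rewrite -(natrD _ _ 1) addn1.
rewrite nE sE; move: mab IHle IHeq n0 => + + + /=.
have := xab n.+1; rewrite -/y; set k := n.+1%:R => yab mab IHle IHeq k0.
have k1 : k + 1 != 0 by lra.
set m' := (k * m + y) / (k + 1).
have [ym|ym] := eqVneq y m.
  have m'E : m' = m by rewrite /m' ym; field.
  rewrite m'E ym; split=> //; first lra.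
  move=> e i; rewrite leq_eqVlt ltnS => /orP[/eqP -> //|ile].
  by apply: IHeq => //; lra.
pose t := k / (k + 1).
have t01 : 0 < t < 1.
  apply/andP; split; first by apply: divr_gt0; lra.
  by rewrite ltr_pdivrMr; lra.
have m'E : m' = t * m + (1 - t) * y by rewrite /m' /t; field.
have lt_m' : (k + 1) * f m' < k * f m + f y.
  have -> : k * f m + f y = (k + 1) * (t * f m + (1 - t) * f y).
    by rewrite /t; field.
  rewrite ltr_pM2l; last lra.
  by rewrite m'E; apply: fcvx; rewrite /= ?in_itv //= eq_sym.
split; [|lra|by move=> e; exfalso; lra].
by rewrite m'E; nra.
Qed.

End Convexity.

(** * Sums over one period *)

Section CyclicSums.
Variables (V : zmodType) (M : nat).

Lemma sum_periodic_shift (g : nat -> V) (i : nat) :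
  (forall n, g (n + M)%N = g n) ->
  \sum_(k < M) g (i + k)%N = \sum_(k < M) g k.
Proof.
move=> gM; elim: i => [//|i <-].
case: M gM => [|m] gM; first by rewrite !big_ord0.
rewrite [LHS]big_ord_recr [RHS]big_ord_recl /= addrC addn0.
congr (_ + _); first by rewrite addSnnS gM.
by apply: eq_bigr => k _; rewrite addSnnS.
Qed.

(** Raising [k] by one adds the consecutive differences over one full period, which telescope to
    [p]. *)
Lemma sum_gaps (u : nat -> V) (p : V) (k : nat) :
  (forall n, u (n + M)%N = u n + p) ->
  \sum_(i < M) (u (i + k)%N - u i) = p *+ k.
Proof.
move=> uM; elim: k => [|k IH].
  by rewrite big1 // => i _; rewrite addn0 subrr.
have -> : \sum_(i < M) (u (i + k.+1)%N - u i) =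
    \sum_(i < M) (u (i.+1 + k)%N - u (i + k)%N) +
    \sum_(i < M) (u (i + k)%N - u i).
  by rewrite -big_split; apply: eq_bigr => i _; rewrite /= addSnnS addrA subrK.
rewrite IH mulrS; congr (_ + _).
rewrite -(big_mkord xpredT (fun i => u (i.+1 + k)%N - u (i + k)%N)).
rewrite (telescope_sumr (fun i => u (i + k)%N)) // addnC uM add0n.
by rewrite addrAC subrr add0r.
Qed.

End CyclicSums.

(** * Lower bound for the cyclic energy, with its equality case *)

Section CyclicEnergy.
Variables (R : realType) (N : nat) (f : R -> R).
Hypothesis N_gt0 : (0 < N)%N.
Hypothesis f_periodic : forall s, f (s + 2) = f s.

(** For fixed [i] the summand is periodic in [j], so [j] may run over the period that starts at
    [i]. *)
Lemma cyclic_double_sum (u : nat -> R) :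
  (forall n, u (n + (N + N))%N = u n + 2) ->
  \sum_(i < N + N) \sum_(j < N + N) f (u j - u i) =
  \sum_(k < N + N) \sum_(i < N + N) f (u (i + k)%N - u i).
Proof.
move=> uM; rewrite [RHS]exchange_big; apply: eq_bigr => i _ /=.
rewrite (sum_periodic_shift (g := fun n => f (u n - u i))) // => n.
by rewrite uM addrAC f_periodic.
Qed.

Lemma cyclic_energy_affine (c : R) (u := fun n : nat => n%:R / N%:R + c) :
  \sum_(i < N + N) \sum_(j < N + N) f (u j - u i) =
  \sum_(k < N + N) (N + N)%:R * f (k%:R / N%:R).
Proof.
have N0 : N%:R != 0 :> R by rewrite pnatr_eq0 -lt0n.
rewrite cyclic_double_sum => [|n]; last by rewrite /u !natrD; field.
apply: eq_bigr => k _.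
rewrite (eq_bigr (fun=> f (k%:R / N%:R))) => [|i _].
  by rewrite sumr_const card_ord [RHS]mulr_natl.
by congr (f _); rewrite /u natrD; field.
Qed.

Lemma cyclic_energy_ge (u : nat -> R) :
  strictly_convex_on `[0, 2] f ->
  (forall n, u (n + (N + N))%N = u n + 2) ->
  (forall n, u n <= u n.+1) ->
  let E := \sum_(i < N + N) \sum_(j < N + N) f (u j - u i) in
  let E0 := \sum_(k < N + N) (N + N)%:R * f (k%:R / N%:R) in
  E0 <= E /\ (E <= E0 -> forall n, (n < N + N)%N -> u n = u 0%N + n%:R / N%:R).
Proof.
move=> fcvx uM umono /=; rewrite cyclic_double_sum //.
have N0 : N%:R != 0 :> R by rewrite pnatr_eq0 -lt0n.
have u_homo : {homo u : m n / (m <= n)%N >-> m <= n}.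
  exact: (homo_leq (@lexx _ R) (@le_trans _ R)).
(* Since [k] is below the period, [u (i + k)] lies between [u i] and [u (i + (N + N))], which is
   [u i + 2]. *)
have gap_itv k i : (k < N + N)%N -> 0 <= u (i + k)%N - u i <= 2.
  move=> kM; rewrite subr_ge0 u_homo ?leq_addr //= lerBlDl -uM.
  by rewrite u_homo // leq_add2l ltnW.
have jensen k : (k < N + N)%N ->
    (N + N)%:R * f (k%:R / N%:R) <= \sum_(i < N + N) f (u (i + k)%N - u i) /\
    ((N + N)%:R * f (k%:R / N%:R) = \sum_(i < N + N) f (u (i + k)%N - u i) ->
     forall i, (i < N + N)%N -> u (i + k)%N - u i = k%:R / N%:R).
  move=> kM.
  have [M ME] : exists M, (N + N = M.+1)%N by exists (N + N).-1; lia.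
  have := strict_jensen M fcvx (fun i => gap_itv k i kM).
  rewrite /= -ME (sum_gaps _ uM) => -[_].
  have -> : 2 *+ k / (N + N)%:R = k%:R / N%:R :> R.
    by rewrite -mulr_natr natrD; field; rewrite N0 -natrD pnatr_eq0; lia.
  move=> le_sum eq_sum; split => // e i; rewrite ME ltnS; exact: eq_sum.
split; first by apply: ler_sum => k _; case: (jensen k).
move=> Ele.
have lt1M : (1 < N + N)%N by lia.
(* The Jensen defects are nonnegative and their total is at most 0, so each of them vanishes, in
   particular the one for [k = 1]. *)
have /eqP sum0 : \sum_(k < N + N) (\sum_(i < N + N) f (u (i + k)%N - u i) -
    (N + N)%:R * f (k%:R / N%:R)) == 0.
  rewrite eq_le sumrB subr_le0 Ele subr_ge0.
  by apply: ler_sum => k _; case: (jensen k).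
have eq1 : (N + N)%:R * f (1%:R / N%:R) =
    \sum_(i < N + N) f (u (i + 1)%N - u i).
  apply/esym/eqP; rewrite -subr_eq0; apply/eqP.
  apply: (psumr_eq0P _ sum0 (i := Ordinal lt1M)) => // k _.
  by rewrite subr_ge0; case: (jensen k).
elim=> [|n IH] nM; first by rewrite mul0r addr0.
have := (jensen 1%N lt1M).2 eq1 n (ltnW nM).
rewrite addn1 IH ?(ltnW nM) // => /eqP; rewrite subr_eq => /eqP ->.
by rewrite -natr1; ring.
Qed.

End CyclicEnergy.

(** * Extended positions and their continuation beyond one period *)

Section Positions.
Variables (R : realType) (N : nat).
Implicit Types (v : 'cV[R]_(N + N)) (W : 'M[R]_(N + N)).

(** Brings an index of the second half into the reflected form in which positions and weights are
    specified. *)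
Lemma rshift_rev_ord (i : 'I_N) : rshift N i = rev_ord (lshift N (rev_ord i)).
Proof. by apply: val_inj => /=; have := ltn_ord i; lia. Qed.

Lemma extended_weights1 W : extended_weights W ->
  ulsubmx W = (const_mx 1 : 'cV[R]_N) *m (const_mx 1 : 'cV[R]_N)^T ->
  forall i j, W i j = 1.
Proof.
move=> [_ hW] hW1.
have W1 (i j : 'I_N) : W (lshift N i) (lshift N j) = 1.
  have := congr1 (fun A : 'M[R]_N => A i j) hW1.
  by rewrite !mxE big_ord1 !mxE mulr1.
move=> i j; rewrite -(splitK i) -(splitK j).
case: (fintype.split i) => i'; case: (fintype.split j) => j' /=;
  rewrite ?rshift_rev_ord.
- exact: W1.
- by have [<- _ _] := hW i' (rev_ord j'); exact: W1.
- by have [e1 <- _] := hW (rev_ord i') j'; rewrite -e1 W1.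
- by have [e1 e2 <-] := hW (rev_ord i') (rev_ord j'); rewrite -e2 -e1 W1.
Qed.

Lemma extended_position_bounds v i : extended_position v -> 0 < v i 0 < 2.
Proof.
move=> hv; rewrite -(splitK i).
case: (fintype.split i) => j /=; first by have [+ _] := hv j; lra.
by rewrite rshift_rev_ord; have [+ ->] := hv (rev_ord j); lra.
Qed.

Lemma equidistant_extended_position : extended_position (equidistant R N).
Proof.
move=> i; rewrite !mxE /=.
have iN := ltn_ord i.
have N0 : 0 < N%:R :> R by rewrite ltr0n (leq_ltn_trans _ iN).
have iN1 : i%:R + 1 <= N%:R :> R by rewrite natr1 ler_nat.
have i0 : 0 <= i%:R :> R by rewrite ler0n.
split.
  apply/andP; split; first by apply: divr_gt0; lra.
  by rewrite ltr_pdivrMr //; lra.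
rewrite natrB; last by lia.
by rewrite natrD -natr1; field; rewrite gt_eqF.
Qed.

Lemma equidistant_increasing : increasing_order (equidistant R N).
Proof.
move=> i j ij; rewrite !mxE ler_wpM2r ?invr_ge0 ?ler0n //.
by rewrite lerD2r ler_nat.
Qed.

Hypothesis N_gt0 : (0 < N)%N.

Let M_gt0 : (0 < N + N)%N. Proof. by rewrite addn_gt0 N_gt0. Qed.

Definition periodic_positions v (n : nat) : R :=
  v (Ordinal (ltn_pmod n M_gt0)) 0 + 2 * (n %/ (N + N))%:R.

Lemma periodic_positionsE v (i : 'I_(N + N)) : periodic_positions v i = v i 0.
Proof.
rewrite /periodic_positions divn_small // mulr0 addr0; congr (v _ _).
by apply: val_inj; rewrite /= modn_small.
Qed.

Lemma periodic_positionsD v n :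
  periodic_positions v (n + (N + N)) = periodic_positions v n + 2.
Proof.
rewrite /periodic_positions divnDr ?dvdnn // divnn M_gt0 natrD mulrDr mulr1 addrA.
by congr (v _ _ + _ + _); apply: val_inj; rewrite /= modnDr.
Qed.

(** Inside a period this is the given order. At the passage to the next period the added 2 exceeds
    any possible drop, as all positions lie strictly between 0 and 2. *)
Lemma periodic_positions_le v n :
  extended_position v -> increasing_order v ->
  periodic_positions v n <= periodic_positions v n.+1.
Proof.
move=> hv hinc; rewrite /periodic_positions divnS //.
have [dvdM|ndvdM] := boolP ((N + N) %| n.+1)%N.
  rewrite natrD mulrDr mulr1.
  set i := Ordinal (ltn_pmod n _); set j := Ordinal (ltn_pmod n.+1 _).
  have := extended_position_bounds i hv.
  by have := extended_position_bounds j hv; lra.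
by rewrite add0n lerD2r hinc //= modnS (negPf ndvdM).
Qed.

End Positions.

(** * The energy for unit weights and its minimiser *)

Lemma energy_weights1 (R : realType) (N : nat) (Psi : R -> R)
    (v : 'cV[R]_(N + N)) (W : 'M[R]_(N + N)) :
  (forall i j, W i j = 1) ->
  energy Psi v W = 4^-1 * \sum_i \sum_j of_square Psi (v j 0 - v i 0).
Proof.
move=> W1; congr (_ * _).
by apply: eq_bigr => i _; apply: eq_bigr => j _; rewrite W1 mul1r.
Qed.

Theorem theorem5 (R : realType) (N : nat) (Psi : R -> R) (W : 'M[R]_(N + N))
    (hN : (0 < N)%N) (hPsi : penaliser Psi)
    (hPsi2 : twice_continuously_differentiable_on_open `]0, 2[ (of_square Psi))
    (hW : extended_weights W)
    (hW1 : ulsubmx W = (const_mx 1 : 'cV[R]_N) *m (const_mx 1 : 'cV[R]_N)^T) :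
  forall v : 'cV[R]_(N + N),
    minimiser [set u : 'cV[R]_(N + N) | extended_position u /\ increasing_order u]
      (fun u => energy Psi u W) v
    <-> v = equidistant R N.
Proof.
have W1 := extended_weights1 hW hW1.
pose f := of_square Psi.
have fper s : f (s + 2) = f s by exact: penaliser_periodic hPsi s.
(* Symmetry about 1 combines the period 2 with evenness. *)
have fsym s : f (2 - s) = f s by rewrite addrC fper /f /of_square sqrrN.
have fcvx : strictly_convex_on `[0, 2] f.
  apply: strictly_convex_on_reflect fsym (penaliser_strictly_convex hPsi).
  exact: penaliser_decreasing hPsi.
pose E0 := \sum_(k < N + N) (N + N)%:R * f (k%:R / N%:R).
have N0 : N%:R != 0 :> R by rewrite pnatr_eq0 -lt0n.
have E_equidistant : energy Psi (equidistant R N) W = 4^-1 * E0.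
  rewrite (energy_weights1 _ _ W1) /E0.
  (* The equidistant positions are affine in the index, with offset [2^-1 / N]. *)
  rewrite -(cyclic_energy_affine hN fper (2^-1 / N%:R)); congr (_ * _).
  by apply: eq_bigr => i _; apply: eq_bigr => j _; rewrite !mxE !mulrDl.
have E_ge u : extended_position u -> increasing_order u ->
    4^-1 * E0 <= energy Psi u W /\
    (energy Psi u W <= 4^-1 * E0 -> u = equidistant R N).
  move=> upos uinc; rewrite (energy_weights1 _ _ W1).
  have /= [] := cyclic_energy_ge hN fper fcvx (periodic_positionsD hN u)
    (fun n => periodic_positions_le hN n upos uinc).
  have -> : \sum_(i < N + N) \sum_(j < N + N)
      f (periodic_positions hN u j - periodic_positions hN u i) =
      \sum_i \sum_j f (u j 0 - u i 0).
    by apply: eq_bigr => i _; apply: eq_bigr => j _; rewrite !periodic_positionsE.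
  rewrite -/E0 => Ege Eeq; split; first by rewrite ler_pM2l // invr_gt0.
  rewrite ler_pM2l ?invr_gt0 // => /Eeq {Ege}Eeq.
  set c := periodic_positions hN u 0 in Eeq.
  have uE i : u i 0 = c + i%:R / N%:R.
    by rewrite -(periodic_positionsE hN) Eeq.
  (* Equal gaps leave only the offset [c] free. The reflection pairs the first index with the last,
     so [c + (2N - 1) / N = 2 - c], which gives [c = 1 / (2N)]. *)
  have [_] := upos (Ordinal hN); rewrite !uE /= mul0r addr0 => cE.
  have {}cE : c = 2^-1 / N%:R.
    move: cE; rewrite natrB; last lia.
    rewrite natrD => cE.
    have : 2 * c = 1 / N%:R.
      have -> : 1 / N%:R = 2 - (N%:R + N%:R - 1) / N%:R :> R by field.
      lra.
    by rewrite div1r => e; rewrite -e mulrA mulVf ?mul1r.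
  by apply/colP => i; rewrite uE mxE cE mulrDl addrC.
move=> v; split=> [[[vpos vinc] vmin]|->].
  (* A minimiser has at most the energy of the equidistant vector, which is the lower bound, so the
     equality case applies. *)
  apply: (E_ge v vpos vinc).2; rewrite -E_equidistant; apply: vmin.
  split; [exact: equidistant_extended_position|exact: equidistant_increasing].
split=> [|u [upos uinc]].
  split; [exact: equidistant_extended_position|exact: equidistant_increasing].
by rewrite E_equidistant; case: (E_ge u upos uinc).
Qed.
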